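(* Let $k\ge 1$, let $G$ be a graph without isolated vertices, and let $x\in V(G)$. Suppose that $M_k(G)$ is a connected matroid and that $s(x,G)\le \rho^*_k(G)+1$. Then the following are equivalent: (c1) $S(x,G)$ is a cocircuit of $M_k(G)$; (c2) $G\setminus x$ has no tree component.
   Context: Graphs are finite and may have loops and parallel edges. For $X\subseteq E(G)$, $G\langle X\rangle$ is the subgraph of $G$ with edge set $X$ whose vertices are the end-vertices of edges in $X$. $\Delta G=|E(G)|-|V(G)|$. $\mathcal{G}_{\bowtie}$ is the set of graphs having no isolated vertices, no leaves (vertices of degree 1, a loop contributing 2 to the degree), and no cycle components (components that are cycles; a vertex with a single loop is a cycle, and two parallel edges form a cycle). For $k\ge1$ the $k$-circular matroid $M_k(G)$ is the matroid on $E(G)$ whose circuits are the sets $C\subseteq E(G)$ with $\Delta G\langle C\rangle=k$ and $G\langle C\rangle\in\mathcal{G}_{\bowtie}$ (these are known to be the circuits of a matroid). $\rho^*_k(G)$ is the corank of $M_k(G)$, i.e. $|E(G)|$ minus the rank of $M_k(G)$. A matroid is connected if its ground set is nonempty, it has no loops and no coloops, and every two elements belong to a common circuit. $S(x,G)$ is the set of edges of $G$ incident to $x$ (loops included) and $s(x,G)=|S(x,G)|$. $G\setminus x$ is $G$ with vertex $x$ and all edges incident to it deleted. A tree component is a component that is a tree; an isolated vertex counts as a tree. *)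

(* Defs.v *)
From mathcomp Require Import all_boot all_order all_algebra.
From mathcomp Require Import zify.

Set Implicit Arguments.
Unset Strict Implicit.
Unset Printing Implicit Defensive.

(* Vertices and edges are subsets of ambient finite types, so that subgraphs
   of [G] are again of type [graph V E].  An edge is a loop when [ends G e] is
   a singleton; distinct edges may have the same ends. *)
Record graph (V E : finType) := Graph {
  vset : {set V};
  eset : {set E};
  ends : E -> {set V};
  ends_sub : forall e, e \in eset -> ends e \subset vset;
  ends_card : forall e, e \in eset -> 0 < #|ends e| <= 2
}.

Section Graphs.
Variables V E : finType.
Implicit Types (G : graph V E) (X Y : {set E}) (W : {set V}) (v u x : V).

Definition star G v : {set E} := [set e in eset G | v \in ends G e].

Definition deg G v : nat :=
  #|star G v| + #|[set e in eset G | ends G e == [set v]]|.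

Definition Delta G : int := (#|eset G|%:Z - #|vset G|%:Z)%R.

Definition adj G : rel V :=
  fun u v => [exists e in eset G, ends G e == [set u; v]].

Definition is_connected G : bool :=
  (vset G != set0) &&
  [forall u in vset G, forall v in vset G, connect (adj G) u v].

Fact edge_subgraph_sub G X e : e \in X :&: eset G ->
  ends G e \subset \bigcup_(f in X :&: eset G) ends G f.
Proof. by move=> eX; apply: bigcup_sup eX. Qed.

Fact edge_subgraph_card G X e : e \in X :&: eset G -> 0 < #|ends G e| <= 2.
Proof. by case/setIP=> _; apply: ends_card. Qed.

Definition edge_subgraph G X : graph V E :=
  Graph (@edge_subgraph_sub G X) (@edge_subgraph_card G X).

Fact induced_sub G W e : e \in [set e in eset G | ends G e \subset W] ->
  ends G e \subset vset G :&: W.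
Proof.
by rewrite inE => /andP[eG eW]; rewrite subsetI eW andbT ends_sub.
Qed.

Fact induced_card G W e : e \in [set e in eset G | ends G e \subset W] ->
  0 < #|ends G e| <= 2.
Proof. by rewrite inE => /andP[eG _]; apply: ends_card. Qed.

Definition induced G W : graph V E :=
  Graph (@induced_sub G W) (@induced_card G W).

Definition del_vertex G x : graph V E := induced G [set~ x].

(* The component of [G] that contains [v], for [v \in vset G]. *)
Definition component G v : graph V E :=
  induced G [set u | connect (adj G) v u].

(* By the convention on loops, a vertex with a single loop and a pair of
   parallel edges are cycles. *)
Definition is_cycle G : bool :=
  is_connected G && [forall v in vset G, deg G v == 2].

Definition acyclic G : bool :=
  [forall X : {set E}, (X \subset eset G) ==> ~~ is_cycle (edge_subgraph G X)].

Definition is_tree G : bool := is_connected G && acyclic G.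

Definition has_tree_component G : bool :=
  [exists v in vset G, is_tree (component G v)].

Definition no_isolated G : bool := [forall v in vset G, deg G v != 0].

Definition no_leaf G : bool := [forall v in vset G, deg G v != 1].

Definition no_cycle_component G : bool :=
  [forall v in vset G, ~~ is_cycle (component G v)].

Definition bowtie G : bool :=
  [&& no_isolated G, no_leaf G & no_cycle_component G].

End Graphs.

Record matroid (E : finType) := Matroid {
  ground : {set E};
  circuits : {set {set E}};
  circuit_sub : forall C, C \in circuits -> C \subset ground;
  circuit_neq0 : set0 \notin circuits;
  circuit_inj : forall C1 C2, C1 \in circuits -> C2 \in circuits ->
    C1 \subset C2 -> C1 = C2;
  circuit_elim : forall C1 C2 e, C1 \in circuits -> C2 \in circuits ->
    C1 != C2 -> e \in C1 :&: C2 ->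
    exists2 C3, C3 \in circuits & C3 \subset (C1 :|: C2) :\ e
}.

Section Matroids.
Variables (E : finType) (M : matroid E).
Implicit Types (X B : {set E}) (e : E).

Definition indep X : bool :=
  (X \subset ground M) && [forall C in circuits M, ~~ (C \subset X)].

Definition basis B : bool := maxset indep B.

Definition rank : nat := \max_(X | indep X) #|X|.

Definition corank : nat := #|ground M| - rank.

(* [cobasis], [coindep] and [cocircuit] are the bases, independent sets and
   circuits of the dual matroid. *)
Definition cobasis B : bool := (B \subset ground M) && basis (ground M :\: B).

Definition coindep X : bool := [exists B, cobasis B && (X \subset B)].

Definition cocircuit X : bool :=
  minset (fun Y => (Y \subset ground M) && ~~ coindep Y) X.

Definition is_loop e : bool := [set e] \in circuits M.

Definition is_coloop e : bool := cocircuit [set e].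

Definition connected_matroid : Prop :=
  [/\ ground M != set0,
      forall e, e \in ground M -> ~~ is_loop e,
      forall e, e \in ground M -> ~~ is_coloop e
    & forall e f, e \in ground M -> f \in ground M -> e != f ->
        exists C, [/\ C \in circuits M, e \in C & f \in C]].

End Matroids.

Section Circular.
Variables V E : finType.
Implicit Types (G : graph V E) (X Y C : {set E}) (k : nat).

Definition circular_circuits k G : {set {set E}} :=
  [set C : {set E} | [&& C \subset eset G, Delta (edge_subgraph G C) == k%:Z%R
                       & bowtie (edge_subgraph G C)]].

Lemma circular_circuit_sub k G C :
  C \in circular_circuits k G -> C \subset eset G.
Proof. by rewrite inE => /and3P[]. Qed.

Definition cov G X := \bigcup_(e in X) ends G e.

Lemma vsetE G X : X \subset eset G -> vset (edge_subgraph G X) = cov G X.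
Proof. by move=> /setIidPl /= ->. Qed.

Lemma esetE G X : X \subset eset G -> eset (edge_subgraph G X) = X.
Proof. by move=> /setIidPl /= ->. Qed.

Lemma covS G X Y : X \subset Y -> cov G X \subset cov G Y.
Proof.
move=> /subsetP XY; apply/bigcupsP=> e /XY eY; exact: bigcup_sup eY.
Qed.

Lemma deg_sum G v :
  deg G v = \sum_(e in eset G) ((v \in ends G e) + (ends G e == [set v])).
Proof.
rewrite big_split /= /deg /star.
by congr (_ + _); rewrite -sum1_card big_mkcond [RHS]big_mkcond /=;
   apply: eq_bigr => e _; rewrite inE; case: (_ \in eset G) => //=; case: ifP.
Qed.

Lemma inc_sum G e (W : {set V}) : e \in eset G ->
  \sum_(v in W) ((v \in ends G e) + (ends G e == [set v]))
    <= 1 + (ends G e \subset W)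
  /\ (ends G e \subset W ->
      \sum_(v in W) ((v \in ends G e) + (ends G e == [set v])) = 2).
Proof.
move=> eG; rewrite big_split /=.
have -> : \sum_(i in W) (i \in ends G e) = #|ends G e :&: W|.
  rewrite -sum1_card big_mkcond [RHS]big_mkcond /=; apply: eq_bigr => v _.
  by rewrite inE andbC; case: (v \in W) => //=; case: (_ \in _).
have -> : \sum_(i in W) (ends G e == [set i])
          = #|[set v in W | ends G e == [set v]]|.
  rewrite -sum1_card big_mkcond [RHS]big_mkcond /=; apply: eq_bigr => v _.
  by rewrite inE; case: (v \in W) => //=; case: (_ == _).
have /andP[c0 c2] := ends_card eG.
have [/eqP/cards1P[a ea]|c1] := eqVneq #|ends G e| 1.
  rewrite ea; have -> : [set v in W | [set a] == [set v]] = [set a] :&: W.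
    apply/setP=> v; rewrite !inE andbC; congr (_ && _).
    by apply/eqP/eqP=> [/set1_inj|->].
  have [aW|aW] := boolP (a \in W).
    have /setIidPl -> : [set a] \subset W by rewrite sub1set.
    by rewrite cards1 sub1set aW.
  have -> : [set a] :&: W = set0.
    by apply/setP=> v; rewrite !inE; case: eqP => // ->; rewrite (negbTE aW).
  by rewrite cards0 sub1set (negbTE aW).
have -> : [set v in W | ends G e == [set v]] = set0.
  apply/setP=> v; rewrite !inE; apply/negbTE/negP=> /andP[_ /eqP ev].
  by rewrite ev cards1 in c1.
have ce : #|ends G e| = 2 by case: #|ends G e| c0 c1 c2 => [|[|[|?]]].
rewrite cards0 addn0; split; last by move/setIidPl->.
case: (boolP (_ \subset W)) => [/setIidPl->|nsub]; first by rewrite ce.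
rewrite addn0 -ltnS -ce; apply: proper_card.
by rewrite properEneq subsetIl andbT; apply: contraNneq nsub => /setIidPl.
Qed.

Lemma handshake G : \sum_(v in vset G) deg G v = 2 * #|eset G|.
Proof.
under eq_bigr => v _ do rewrite deg_sum.
rewrite exchange_big /= mulnC -sum_nat_const.
by apply: eq_bigr => e eG; apply: (inc_sum _ eG).2; apply: ends_sub.
Qed.

Lemma adj_sym G : symmetric (adj G).
Proof. by move=> u v; apply: eq_existsb => e; rewrite setUC. Qed.

Lemma adjP G e u v : e \in eset G -> u \in ends G e -> v \in ends G e ->
  connect (adj G) u v.
Proof.
move=> eG ue ve; have [->|uv] := eqVneq u v; first exact: connect0.
apply/connect1/existsP; exists e; rewrite eG /= eq_sym eqEcard cards2 uv.
have /andP[_ ->] := ends_card eG.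
by rewrite andbT; apply/subsetP=> w; rewrite !inE => /orP[]/eqP->.
Qed.

Lemma comp_ends G v u e : connect (adj G) v u -> e \in eset G ->
  u \in ends G e -> ends G e \subset [set u | connect (adj G) v u].
Proof.
move=> vu eG ue; apply/subsetP=> w we; rewrite inE.
by apply: connect_trans vu _; apply: adjP eG ue we.
Qed.

Lemma comp_star G v u : connect (adj G) v u ->
  star (component G v) u = star G u.
Proof.
move=> vu; apply/setP=> e; rewrite !inE -andbA; apply: andb_id2l => eG.
by apply/andb_idl => ue; apply: comp_ends vu eG ue.
Qed.

Lemma comp_deg G v u : connect (adj G) v u -> deg (component G v) u = deg G u.
Proof.
move=> vu; rewrite /deg comp_star //; congr (_ + #|pred_of_set _|).
apply/setP=> e; rewrite !inE -andbA; apply: andb_id2l => eG.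
apply/andb_idl => /eqP eu; apply: comp_ends vu eG _.
by rewrite eu set11.
Qed.

Lemma comp_connected G v : v \in vset G -> is_connected (component G v).
Proof.
move=> vG; apply/andP; split.
  by apply/set0Pn; exists v; rewrite !inE vG connect0.
have cv u : connect (adj G) v u -> connect (adj (component G v)) v u.
  case/connectP=> p; elim/last_ind: p u => [|p w IH] u; first by move=> _ ->.
  rewrite rcons_path last_rcons => /andP[vp pw] ->{u}.
  apply: connect_trans (IH _ vp erefl) _; apply: connect1.
  case/existsP: pw => e /andP[eG eE]; apply/existsP; exists e.
  rewrite /= eE inE eG !andbT /=; apply: (@comp_ends _ _ (last v p)) => //.
    by apply/connectP; exists p.
  by rewrite (eqP eE) !inE eqxx.
apply/'forall_implyP=> u; rewrite !inE => /andP[_ vu].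
apply/'forall_implyP=> w; rewrite !inE => /andP[_ vw].
apply: connect_trans (cv _ vw).
by rewrite (sym_connect_sym (@adj_sym _)) cv.
Qed.

(* A proper subset of the edges of a bowtie graph spans a graph of smaller
   [Delta]. *)
Lemma bowtie_strict G X Y : X \subset eset G -> bowtie (edge_subgraph G X) ->
  Y \proper X -> #|cov G X| + #|Y| < #|X| + #|cov G Y|.
Proof.
move=> XG /and3P[/'forall_implyP iX /'forall_implyP lX /'forall_implyP cX].
case/properP=> YX [e0 e0X e0Y].
set H := edge_subgraph G X in iX lX cX.
have vH : vset H = cov G X by apply: vsetE.
have eH : eset H = X by apply: esetE.
set W := cov G X :\: cov G Y.
have cW : #|W| + #|cov G Y| = #|cov G X|.
  by rewrite cardsD (setIidPr (covS G YX)) subnK // subset_leq_card // covS.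
have cXY : #|X :\: Y| + #|Y| = #|X|.
  by rewrite cardsD (setIidPr YX) subnK // subset_leq_card.
suff : #|W| < #|X :\: Y| by lia.
have deg2 v : v \in W -> 2 <= deg H v.
  case/setDP=> vX _; rewrite -vH in vX.
  by move: (iX _ vX) (lX _ vX); case: (deg H v) => [|[]].
pose s e := \sum_(v in W) ((v \in ends H e) + (ends H e == [set v])).
have sumE : \sum_(v in W) deg H v = \sum_(e in X :\: Y) s e.
  under eq_bigr => v _ do rewrite deg_sum.
  rewrite exchange_big eH [RHS]big_mkcond [LHS]big_mkcond.
  apply: eq_bigr => e _ /=; rewrite inE; case eX: (e \in X); rewrite ?andbF //.
  case eY: (e \in Y) => //=; apply: big1 => v /setDP[_ vY].
  have vne : v \notin ends G e.
    by apply: contra vY => ve; apply/bigcupP; exists e.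
  rewrite (negbTE vne); case: eqP => // ev.
  by rewrite ev set11 in vne.
have s2 e : e \in X :\: Y -> s e <= 1 + (ends H e \subset W).
  by case/setDP=> eX _; apply: (inc_sum _ _).1; rewrite eH.
have s2' e : e \in X :\: Y -> s e <= 2.
  by move/s2=> /leq_trans; apply; case: (_ \subset _).
have le1 : \sum_(v in W) 2 <= \sum_(v in W) deg H v by apply: leq_sum.
have le2 : \sum_(e in X :\: Y) s e <= \sum_(e in X :\: Y) 2 by apply: leq_sum.
rewrite ltn_neqAle; apply/andP; split; last first.
  by move: le1 le2; rewrite sumE !sum_nat_const; lia.
apply/eqP=> cWX.
have eqd : \sum_(v in W) deg H v = \sum_(v in W) 2.
  by move: le1 le2; rewrite sumE !sum_nat_const; lia.
have eqs : \sum_(e in X :\: Y) s e = \sum_(e in X :\: Y) 2.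
  by rewrite -sumE eqd !sum_nat_const cWX.
have dW v : v \in W -> deg H v = 2.
  move=> vW; apply/eqP; rewrite eqn_leq deg2 // andbT.
  have : \sum_(u in W | u != v) 2 <= \sum_(u in W | u != v) deg H u.
    by apply: leq_sum => u /andP[/deg2].
  by move: eqd; rewrite (bigD1 v) //= [RHS](bigD1 v) //=; lia.
have eW e : e \in X :\: Y -> ends H e \subset W.
  move=> eXY; have : \sum_(f in X :\: Y | f != e) s f
                     <= \sum_(f in X :\: Y | f != e) 2.
    by apply: leq_sum => f /andP[/s2'].
  move: eqs (s2 _ eXY); rewrite (bigD1 e) //= [RHS](bigD1 e) //=.
  by case: (_ \subset W) => //; lia.
have : 0 < #|W|.
  by rewrite cWX; apply/card_gt0P; exists e0; rewrite inE e0X e0Y.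
case/card_gt0P=> w wW.
have wH : w \in vset H by rewrite vH; case/setDP: wW.
have KW u : connect (adj H) w u -> u \in W.
  case/connectP=> p; elim: p w wW {wH} => [|y p IH] w wW /=; first by move=> _ ->.
  case/andP=> /existsP[e /andP[eX /eqP ee]]; apply: IH.
  rewrite eH in eX; have [eY|eY] := boolP (e \in Y).
    case/setDP: wW => _ /bigcupP[]; exists e => //.
    by rewrite [ends G e]ee !inE eqxx.
  have /subsetP -> // : ends H e \subset W by rewrite eW // inE eX eY.
  by rewrite ee !inE eqxx orbT.
have /negP[] := cX _ wH.
rewrite /is_cycle comp_connected //; apply/'forall_implyP=> u.
rewrite !inE => /andP[_ wu]; rewrite comp_deg //; apply/eqP; exact/dW/KW.
Qed.

Lemma circuitP k G X : X \in circular_circuits k G ->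
  [/\ X \subset eset G, bowtie (edge_subgraph G X) & #|X| = #|cov G X| + k].
Proof.
rewrite inE => /and3P[XG /eqP D B]; split=> //.
by move: D; rewrite /Delta vsetE // esetE //; lia.
Qed.

(* An edge set with [Delta] at least [k] contains a circuit. *)
Lemma dep_circuit k G X : 0 < k -> X \subset eset G ->
  #|cov G X| + k <= #|X| ->
  exists2 C, C \in circular_circuits k G & C \subset X.
Proof.
move=> k0 XG dX; pose P (Y : {set E}) := #|cov G Y| + k <= #|Y|.
have [Y /minsetP[PY minY] YX] := minset_exists (P := P) dX.
have YG := subset_trans YX XG; exists Y => //.
have smaller (Z : {set E}) : Z \proper Y -> #|Z| < #|cov G Z| + k.
  move=> ZY; rewrite ltnNge; apply/negP=> PZ; move: (ZY).
  by rewrite (minY _ PZ (proper_sub ZY)) properxx.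
have D1 e : e \in Y -> #|Y| = #|Y :\ e|.+1 by move=> eY; rewrite (cardsD1 e) eY.
have Y0 : 0 < #|Y| by move: PY; rewrite /P; lia.
have cY : #|Y| = #|cov G Y| + k.
  have [e eY] := card_gt0P Y0; move: PY; rewrite /P.
  have := smaller _ (properD1 eY).
  by have := subset_leq_card (covS G (subD1set Y e)); have := D1 _ eY; lia.
set H := edge_subgraph G Y.
have vH : vset H = cov G Y by apply: vsetE.
have eH : eset H = Y by apply: esetE.
rewrite inE; apply/and3P; split; first exact: YG.
  by rewrite /Delta -/H vH eH; apply/eqP; lia.
apply/and3P; split; apply/'forall_implyP=> v vv; have vY := vv; rewrite vH in vY.
- case/bigcupP: vY => e eY ve; rewrite -lt0n /deg addn_gt0.
  by apply/orP; left; apply/card_gt0P; exists e; rewrite inE eH eY.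
- apply/eqP=> d1; case/bigcupP: (vY) => e eY ve.
  have eS : e \in star H v by rewrite inE eH eY.
  have S1 : star H v = [set e].
    apply/eqP; rewrite eq_sym eqEcard sub1set eS cards1.
    by rewrite -d1 leq_addr.
  have sub : cov G (Y :\ e) \subset cov G Y :\ v.
    apply/bigcupsP=> f /setD1P[fe fY]; apply/subsetP=> w wf; rewrite !inE.
    apply/andP; split; last by apply/bigcupP; exists f.
    apply: contraNneq fe => wv; have : f \in star H v.
      by rewrite inE eH fY -wv.
    by rewrite S1 inE.
  have := subset_leq_card sub; have := cardsD1 v (cov G Y); rewrite vY.
  by have := smaller _ (properD1 eY); have := D1 _ eY; lia.
- apply/negP=> /andP[_ /'forall_implyP d2].
  set K := component H v in d2.
  have cK : #|eset K| = #|vset K|.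
    have := handshake K.
    rewrite (eq_bigr (fun=> 2)) ?sum_nat_const; first by lia.
    by move=> u /d2/eqP.
  have KY : eset K \subset Y by apply/subsetP=> e; rewrite inE eH => /andP[].
  have vKY : vset K \subset cov G Y by rewrite -vH subsetIl.
  have vK0 : 0 < #|vset K|.
    by apply/card_gt0P; exists v; rewrite !inE vv connect0.
  have pY : Y :\: eset K \proper Y.
    rewrite properEcard subsetDl cardsD (setIidPr KY).
    by have := subset_leq_card KY; lia.
  have sub : cov G (Y :\: eset K) \subset cov G Y :\: vset K.
    apply/bigcupsP=> f /setDP[fY fK]; apply/subsetP=> w wf; rewrite inE.
    apply/andP; split; last by apply/bigcupP; exists f.
    apply: contra fK => /setIP[_]; rewrite inE => vw.
    by rewrite inE eH fY; apply: comp_ends vw _ wf; rewrite eH.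
  have := subset_leq_card sub; have := smaller _ pY.
  rewrite !cardsD (setIidPr KY) (setIidPr vKY).
  by have := subset_leq_card KY; have := subset_leq_card vKY; lia.
Qed.

Lemma circular_circuit_neq0 k G : 0 < k -> set0 \notin circular_circuits k G.
Proof. by move=> k0; apply/negP=> /circuitP[_ _]; rewrite cards0; lia. Qed.

Lemma circular_circuit_inj k G C1 C2 : C1 \in circular_circuits k G ->
  C2 \in circular_circuits k G -> C1 \subset C2 -> C1 = C2.
Proof.
move=> /circuitP[_ _ c1] /circuitP[G2 b2 c2] C12; apply/eqP.
rewrite eqEproper C12; apply/negP=> /(bowtie_strict G2 b2); lia.
Qed.

Lemma circular_circuit_elim k G C1 C2 (e : E) : 0 < k ->
  C1 \in circular_circuits k G -> C2 \in circular_circuits k G ->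
  C1 != C2 -> e \in C1 :&: C2 ->
  exists2 C3, C3 \in circular_circuits k G & C3 \subset (C1 :|: C2) :\ e.
Proof.
move=> k0 C1C C2C C12 eI.
have [G1 b1 c1] := circuitP C1C; have [G2 b2 c2] := circuitP C2C.
have pI : C1 :&: C2 \proper C1.
  rewrite properEneq subsetIl andbT; apply: contraNneq C12 => /setIidPl sub.
  by rewrite (circular_circuit_inj C1C C2C sub).
apply: dep_circuit => //.
  by rewrite (subset_trans (subD1set _ _)) // subUset G1.
have := bowtie_strict G1 b1 pI.
have := subset_leq_card (covS G (subD1set (C1 :|: C2) e)).
have eU : e \in C1 :|: C2 by case/setIP: eI => eC1 _; rewrite inE eC1.
have := cardsD1 e (C1 :|: C2); rewrite eU.
have cU : cov G (C1 :|: C2) = cov G C1 :|: cov G C2 by apply: bigcup_setU.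
have sI : cov G (C1 :&: C2) \subset cov G C1 :&: cov G C2.
  by rewrite subsetI !covS ?subsetIl ?subsetIr.
have := subset_leq_card sI; have := cardsUI C1 C2.
by have := cardsUI (cov G C1) (cov G C2); rewrite cU; lia.
Qed.

Definition circular_matroid k (k0 : 0 < k) G : matroid E :=
  @Matroid E (eset G) (circular_circuits k G)
    (@circular_circuit_sub k G) (circular_circuit_neq0 G k0)
    (@circular_circuit_inj k G)
    (fun C1 C2 e => @circular_circuit_elim k G C1 C2 e k0).

End Circular.

(* Main.v *)
Require Import Defs.
From mathcomp Require Import all_boot.
From mathcomp Require Import zify.

Set Implicit Arguments.
Unset Strict Implicit.
Unset Printing Implicit Defensive.

(** Independence in [M_k(G)] means [|Y| <= |cov Y| + k - 1] for every
    [Y \subset X].  As [Y |-> |cov Y| + k - 1] is submodular, monotone and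
    nonnegative even at the empty set, the tight subsets of an independent set
    are closed under union, and the rank of [X] is the minimum of [|X|] and of
    [|X \ A| + |cov A| + k - 1] over [A \subset X].  An element outside a
    minimizing [A] for [X = E(G)] would be a coloop, so [M_k(G)] has rank
    [|V| + k - 1].  Adding an edge of [S(x)] to an independent set of [G \ x]
    keeps it independent, so [S(x)] is a cocircuit exactly when [G \ x] has rank
    [|V| + k - 2].  A tree component makes the rank too small; without one, any
    set [U] of vertices of [G \ x] meets at least [|U|] edges, and the rank
    formula gives the bound. *)

(** * Cycles, trees and edge counts *)

Definition inc (V E : finType) (G : graph V E) (U : {set V}) : {set E} :=
  [set e in eset G | ~~ [disjoint ends G e & U]].

(** Allows a component of an edge subgraph to be exchanged for the subgraph spanned by its own
    edges; the two records are not convertible. *)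
Lemma is_cycle_congr (V E : finType) (G H : graph V E) :
  vset G = vset H -> eset G = eset H -> ends G =1 ends H ->
  is_cycle G = is_cycle H.
Proof.
move=> eqV eqE eqe.
have eqa : adj G =2 adj H.
  by move=> u v; apply: eq_existsb => e; rewrite eqE eqe.
rewrite /is_cycle /is_connected eqV; apply: (f_equal2 andb).
  apply: (f_equal2 andb (erefl _)).
  apply: eq_forallb => u; congr (_ ==> _); apply: eq_forallb => v.
  by congr (_ ==> _); apply: eq_connect.
apply: eq_forallb => v; congr (_ ==> (_ == _)); rewrite !deg_sum eqE.
by apply: eq_bigr => e _; rewrite eqe.
Qed.

Lemma cycle_card (V E : finType) (G : graph V E) :
  is_cycle G -> #|eset G| = #|vset G| /\ 0 < #|vset G|.
Proof.
case/andP=> /andP[n0 _] /'forall_implyP d2; rewrite card_gt0; split=> //.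
have := handshake G; rewrite (eq_bigr (fun=> 2)) ?sum_nat_const.
  by clear; lia.
by move=> u /d2/eqP.
Qed.

(** If there were as many edges as vertices, a minimal nonempty [X] with [#|cov G X| <= #|X|] would
    have no leaf, and without a cycle component it would keep the inequality after losing an edge.
    So it contains a cycle. *)
Lemma tree_card (V E : finType) (G : graph V E) :
  is_tree G -> #|eset G| < #|vset G|.
Proof.
case/andP=> /andP[V0 _] /'forall_implyP acy; rewrite ltnNge; apply/negP=> le.
pose P (X : {set E}) := [&& X \subset eset G, X != set0 & #|cov G X| <= #|X|].
have PE : P (eset G).
  rewrite /P subxx -card_gt0 (leq_trans _ le) ?card_gt0 //=.
  apply: leq_trans le; apply: subset_leq_card.
  by apply/bigcupsP=> e /ends_sub.
have [X /minsetP[/and3P[XG X0 cX] minX] _] := minset_exists (P := P) PE.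
have D1 e : e \in X -> #|X| = #|X :\ e|.+1 by move=> eX; rewrite (cardsD1 e) eX.
have smaller e : e \in X -> 1 < #|X| -> #|X :\ e| < #|cov G (X :\ e)|.
  move=> eX X1; rewrite ltnNge; apply/negP=> le'.
  have /minX : P (X :\ e).
    rewrite /P le' andbT (subset_trans (subD1set _ _)) //= -card_gt0.
    by have := D1 e eX; move: X1; clear; lia.
  by move/(_ (subD1set _ _))/setP/(_ e); rewrite eX !inE eqxx.
set H := edge_subgraph G X.
have vH : vset H = cov G X by apply: vsetE.
have eH : eset H = X by apply: esetE.
have iso : no_isolated H.
  apply/'forall_implyP=> v; rewrite vH => /bigcupP[e eX ve].
  rewrite -lt0n /deg addn_gt0; apply/orP; left; apply/card_gt0P; exists e.
  by rewrite inE eH eX.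
have leaf : no_leaf H.
  apply/'forall_implyP=> v; rewrite vH => vY; apply/eqP=> d1.
  case/bigcupP: (vY) => e eX ve.
  have eS : e \in star H v by rewrite inE eH eX.
  have S1 : star H v = [set e].
    apply/eqP; rewrite eq_sym eqEcard sub1set eS cards1.
    by rewrite -d1 leq_addr.
  have sub : cov G (X :\ e) \subset cov G X :\ v.
    apply/bigcupsP=> f /setD1P[fe fX]; apply/subsetP=> w wf; rewrite !inE.
    apply/andP; split; last by apply/bigcupP; exists f.
    apply: contraNneq fe => wv; have : f \in star H v.
      by rewrite inE eH fX -wv.
    by rewrite S1 inE.
  (* A leaf edge that is alone in [X] covers at most one vertex, so it is a loop and gives degree
     2. *)
  have X1 : 1 < #|X|.
    rewrite ltnNge; apply/negP=> X1.
    have ev : ends H e = [set v].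
      apply/eqP; rewrite eq_sym eqEcard sub1set ve cards1.
      apply: leq_trans (leq_trans cX X1); apply: subset_leq_card.
      exact: bigcup_sup eX.
    have : 0 < #|[set e in eset H | ends H e == [set v]]|.
      by apply/card_gt0P; exists e; rewrite inE eH eX ev eqxx.
    by move: d1; rewrite /deg S1 cards1; clear; lia.
  have := subset_leq_card sub; have := cardsD1 v (cov G X); rewrite vY.
  by have := smaller _ eX X1; have := D1 _ eX; move: cX; clear; lia.
have [nc|] := boolP (no_cycle_component H).
  have bow : bowtie H by rewrite /bowtie iso leaf nc.
  have p0 : set0 \proper X by rewrite proper0.
  (* Comparison with the empty subset gives [#|cov G X| < #|X|]. *)
  have := bowtie_strict XG bow p0; rewrite /cov big_set0 !cards0 -/(cov G X).
  have [e eX] := set0Pn _ X0 => lt.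
  have c0 : 0 < #|cov G X|.
    have eG : e \in eset G by apply: (subsetP XG).
    have /andP[c0 _] := ends_card eG; apply: leq_trans c0 _.
    exact/subset_leq_card/(bigcup_sup _ eX).
  have X1 : 1 < #|X| by move: lt c0; clear; lia.
  have := subset_leq_card (covS G (subD1set X e)).
  by have := smaller _ eX X1; have := D1 _ eX; move: lt; clear; lia.
case/forallPn=> v; rewrite negb_imply negbK => /andP[vv cyc].
set K := component H v in cyc.
have KX : eset K \subset eset G.
  by apply: subset_trans XG; apply/subsetP=> e; rewrite inE eH => /andP[].
have /negP[] := acy _ KX; rewrite (is_cycle_congr (H := K)) // ?esetE //.
(* All degrees in [K] are 2, so the edges of [K] cover all its vertices. *)
rewrite vsetE //; apply/setP=> w; apply/bigcupP/idP=> [[e eK we]|wK].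
  exact: (subsetP (ends_sub eK)).
case/andP: cyc => _ /'forall_implyP/(_ w wK)/eqP; rewrite deg_sum => d2.
have /exists_inP[e eK we] : [exists e in eset K, w \in ends K e].
  apply: contra_eqT d2; rewrite negb_exists_in => /forall_inP nw.
  rewrite big1 // => e eK; have wn := nw e eK; rewrite (negbTE wn).
  by case: eqP => // ew; rewrite ew set11 in wn.
by exists e.
Qed.

(** A minimal such set is closed under adjacency, and the component of any of its vertices contains
    no cycle. *)
Lemma inc_lt_tree (V E : finType) (G : graph V E) (U : {set V}) :
  U \subset vset G -> #|inc G U| < #|U| -> has_tree_component G.
Proof.
move=> UG ltU; pose P (W : {set V}) := #|inc G W| < #|W|.
have [W /minsetP[PW minW] WU] := minset_exists (P := P) ltU.
have incS (W1 W2 : {set V}) : W1 \subset W2 -> inc G W1 \subset inc G W2.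
  move=> sub; apply/subsetP=> e; rewrite !inE => /andP[-> /=].
  by apply: contra => /disjointWr; apply.
(* By minimality, deleting [Z] from [W] must remove fewer than [|Z|] edges;
   applied to a single vertex with an edge leaving [W], and to the vertex set
   of a cycle. *)
have drop (Z : {set V}) (X : {set E}) : Z \subset W -> Z != set0 ->
    X \subset inc G W -> [disjoint X & inc G (W :\: Z)] -> #|X| < #|Z|.
  move=> ZW Z0 XW dX; rewrite ltnNge; apply/negP=> le.
  have PZ : P (W :\: Z).
    rewrite /P; have : inc G (W :\: Z) \subset inc G W :\: X.
      by rewrite subsetD incS ?subsetDl // disjoint_sym.
    move/subset_leq_card; rewrite !cardsD (setIidPr ZW) (setIidPr XW).
    have := subset_leq_card ZW; have := subset_leq_card XW.
    by move: PW; rewrite /P; move: le; clear; lia.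
  have /setP eqW := minW _ PZ (subsetDl _ _).
  have [z zZ] := set0Pn _ Z0; have := eqW z.
  by rewrite inE zZ (subsetP ZW).
have closed u w : u \in W -> adj G u w -> w \in W.
  move=> uW /existsP[e /andP[eG /eqP ee]]; apply/negPn/negP=> wW.
  suff : #|[set e]| < #|[set u]| by rewrite !cards1.
  apply: drop; rewrite ?sub1set //.
  - by apply/set0Pn; exists u; rewrite set11.
  - rewrite inE eG; apply/pred0Pn; exists u.
    by rewrite /= ee !inE eqxx.
  - rewrite disjoints1 inE eG /= negbK ee disjoint_subset; apply/subsetP=> z.
    by rewrite !inE => /orP[]/eqP->; rewrite ?eqxx // (negbTE wW) andbF.
have /card_gt0P[v vW] : 0 < #|W| by move: PW; rewrite /P; clear; lia.
have KW u : connect (adj G) v u -> u \in W.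
  case/connectP=> p; elim: p v vW => [|y p IH] w wW /=; first by move=> _ ->.
  by case/andP=> /(closed _ _ wW)/IH.
have vG : v \in vset G by apply: (subsetP UG); apply: (subsetP WU).
apply/exists_inP; exists v => //; rewrite /is_tree comp_connected //=.
apply/'forall_implyP=> X XK; apply/negP=> /cycle_card[].
rewrite esetE // vsetE // => cX c0.
suff : #|X| < #|cov (component G v) X| by rewrite cX ltnn.
have XP e : e \in X -> e \in eset G /\ ends G e \subset W.
  move=> /(subsetP XK); rewrite inE => /andP[eG /subsetP eK]; split=> //.
  by apply/subsetP=> w /eK; rewrite inE => /KW.
apply: drop; rewrite -?card_gt0 //.
- by apply/bigcupsP=> e /XP[].
- apply/subsetP=> e /XP[eG eW]; rewrite inE eG.
  have /andP[/card_gt0P[w we] _] := ends_card eG.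
  by apply/pred0Pn; exists w; rewrite /= we (subsetP eW).
- rewrite disjoint_subset; apply/subsetP=> e eX.
  rewrite !inE negb_and negbK; apply/orP; right.
  rewrite disjoint_subset; apply/subsetP=> w we; rewrite !inE negb_and negbK.
  by apply/orP; left; apply/bigcupP; exists e.
Qed.

(** * Rank formula for the circular matroid *)

Section CircularRank.
Variables (V E : finType) (k : nat) (k0 : 0 < k) (G : graph V E).
Implicit Types (A B X Y : {set E}) (e : E).
Local Notation M := (circular_matroid k0 G).

(** A circuit [C] violates the count, having exactly [#|cov G C| + k] edges, and [dep_circuit] finds
    a circuit inside every violating set. *)
Lemma circular_indepP X :
  reflect (X \subset eset G /\ forall Y, Y \subset X -> #|Y| < #|cov G Y| + k)
          (indep M X).
Proof.
apply: (iffP andP) => [[XG /forall_inP nC]|[XG sp]]; split=> //.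
  move=> Y YX; rewrite ltnNge; apply/negP=> le.
  have [C CC CY] := dep_circuit k0 (subset_trans YX XG) le.
  by have := nC _ CC; rewrite (subset_trans CY YX).
apply/forall_inP=> C CC; apply/negP=> /sp.
by have [_ _ ->] := circuitP CC; rewrite ltnn.
Qed.

Lemma circular_indepS X Y : X \subset Y -> indep M Y -> indep M X.
Proof.
move=> XY /circular_indepP[YG sp]; apply/circular_indepP; split.
  exact: subset_trans YG.
by move=> Z ZX; apply: sp; apply: subset_trans XY.
Qed.

Lemma circular_indep0 : indep M set0.
Proof.
apply/circular_indepP; split; first exact: sub0set.
by move=> Y; rewrite subset0 => /eqP->; rewrite cards0 addn_gt0 k0 orbT.
Qed.

(** The easy half of the rank formula: the count applied to [B :&: A]. The strict inequality absorbs
    the term -1. *)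
Lemma indep_cover_bound B A : indep M B -> #|B| < #|B :\: A| + #|cov G A| + k.
Proof.
case/circular_indepP=> _ /(_ _ (subsetIl B A)).
have := subset_leq_card (covS G (subsetIr B A)).
by have := cardsID A B; clear; lia.
Qed.

(** The hard half of the rank formula, with [.+1] in place of the same -1. The set [A] joins the
    largest tight subset of [B] with [X :\: B], which adds nothing to the cover. *)
Lemma max_indep_cover X B :
  X \subset eset G -> maxset (fun Y => indep M Y && (Y \subset X)) B ->
  B = X \/ exists2 A : {set E}, A \subset X &
    #|X :\: A| + #|cov G A| + k <= #|B|.+1.
Proof.
move=> XG /maxsetP[/andP[iB BX] maxB].
have [->|nBX] := eqVneq B X; [by left | right].
have [_ sp] := circular_indepP _ iB.
(* Tight sets satisfy equality, the other inequality being [sp]. *)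
pose tight Y := (Y \subset B) && (#|cov G Y| + k <= #|Y|.+1).
have tightU Y1 Y2 : tight Y1 -> tight Y2 -> tight (Y1 :|: Y2).
  case/andP=> s1 t1 /andP[s2 t2]; rewrite /tight subUset s1 s2 /=.
  have cU : cov G (Y1 :|: Y2) = cov G Y1 :|: cov G Y2 by apply: bigcup_setU.
  have sI : cov G (Y1 :&: Y2) \subset cov G Y1 :&: cov G Y2.
    by rewrite subsetI !covS ?subsetIl ?subsetIr.
  have := sp _ (subset_trans (subsetIl Y1 Y2) s1).
  have := subset_leq_card sI; have := cardsUI Y1 Y2.
  by have := cardsUI (cov G Y1) (cov G Y2); rewrite cU; move: t1 t2; clear; lia.
(* The edge [e] closes a circuit with [B]; removing [e] from it leaves a tight set with the same
   cover. *)
have tight_ends e : e \in X :\: B ->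
    exists2 Y, tight Y & ends G e \subset cov G Y.
  case/setDP=> eX eB; have nI : ~~ indep M (e |: B).
    apply: contra eB => iBe; rewrite -(maxB (e |: B)) ?setU11 ?subsetU1 //.
    by rewrite iBe subUset sub1set eX.
  have eBG : e |: B \subset ground M.
    by rewrite subUset sub1set (subsetP XG) // (subset_trans BX).
  move: nI; rewrite /indep eBG /=.
  case/forall_inPn=> C CC /negPn CeB; have [CG _ cC] := circuitP CC.
  have eC : e \in C.
    apply/negPn/negP=> eC; have : C \subset B.
      apply/subsetP=> f fC; have := subsetP CeB _ fC; rewrite !inE.
      by case/predU1P=> // fe; rewrite -fe fC in eC.
    by move/sp; rewrite cC ltnn.
  have CB : C :\ e \subset B by rewrite subDset.
  have := cardsD1 e C; rewrite eC => cD.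
  have cS := covS G (subD1set C e).
  have lt := sp _ CB; have le := subset_leq_card cS.
  exists (C :\ e); first by rewrite /tight CB; move: cC lt cD le; clear; lia.
  have /eqP -> : cov G (C :\ e) == cov G C.
    by rewrite eqEcard cS; move: cC lt cD le; clear; lia.
  exact: bigcup_sup eC.
(* An edge outside [B] supplies a first tight set; the empty set is not tight when [k > 1]. *)
have [e0 e0D] : exists e, e \in X :\: B.
  by apply/set0Pn; apply: contra nBX; rewrite setD_eq0 eqEsubset BX.
have [Y0 tY0 _] := tight_ends _ e0D.
have [T /maxsetP[tT maxT] _] := maxset_exists (P := tight) tY0.
have subT Y : tight Y -> Y \subset T.
  by move=> tY; rewrite -(maxT (Y :|: T)) ?subsetUl ?subsetUr ?tightU.
case/andP: (tT) => TB cT; exists (T :|: (X :\: B)).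
  by rewrite subUset subsetDl (subset_trans TB).
have cA : cov G (T :|: (X :\: B)) \subset cov G T.
  apply/bigcupsP=> e /setUP[eT|eD]; first exact: bigcup_sup eT.
  have [Y tY] := tight_ends _ eD; move/subset_trans; apply.
  exact/covS/subT.
have -> : X :\: (T :|: (X :\: B)) = B :\: T.
  apply/setP=> e; rewrite !inE; have := subsetP BX e.
  by case: (e \in T); case: (e \in B); case: (e \in X) => // ->.
have := subset_leq_card cA; have := cardsID T B.
by rewrite (setIidPr TB); move: cT; clear; lia.
Qed.

(** The set [A] obtained for [B] bounds every independent [Y] inside [X] as well. *)
Lemma max_indep_card X B Y :
  X \subset eset G -> maxset (fun Z => indep M Z && (Z \subset X)) B ->
  indep M Y -> Y \subset X -> #|Y| <= #|B|.
Proof.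
move=> XG mB iY YX; have [->|[A AX le]] := max_indep_cover XG mB.
  exact: subset_leq_card.
have := indep_cover_bound A iY; have := subset_leq_card (setSD A YX).
by move: le; clear; lia.
Qed.

Lemma max_indep_exists X :
  exists B, maxset (fun Y => indep M Y && (Y \subset X)) B.
Proof.
have P0 : indep M set0 && (set0 \subset X) by rewrite circular_indep0 sub0set.
have [B mB _] := maxset_exists (P := fun Y => indep M Y && (Y \subset X)) P0.
by exists B.
Qed.

Lemma basisE B :
  basis M B = maxset (fun Y => indep M Y && (Y \subset eset G)) B.
Proof. by apply: maxset_eq => Y; rewrite andb_idr // => /andP[]. Qed.

Lemma coindepP X : X \subset eset G ->
  reflect (exists2 B, basis M B & B \subset eset G :\: X) (coindep M X).
Proof.
move=> XG; apply: (iffP existsP) => [[B /andP[/andP[_ bB] XB]]|[B bB BX]].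
  by exists (eset G :\: B); rewrite ?setDS.
have [BG XB] : B \subset eset G /\ [disjoint B & X].
  by apply/andP; rewrite -subsetD.
exists (eset G :\: B); rewrite /cobasis subsetDl setDDr setDv set0U.
by rewrite (setIidPr BG) bB subsetD XG disjoint_sym XB.
Qed.

Lemma basis_avoiding e :
  e \in eset G -> ~~ is_coloop M e -> exists2 B, basis M B & e \notin B.
Proof.
move=> eG; rewrite /is_coloop /cocircuit => /minsetP nmin.
have [/coindepP|ncoe] := boolP (coindep M [set e]).
  rewrite sub1set => /(_ eG)[B bB]; rewrite subsetD => /andP[_ dB].
  by exists B => //; rewrite -disjoints1 disjoint_sym.
(* Otherwise [[set e]] is a cocircuit: its only proper subset is empty, hence coindependent because
   a basis exists. *)
case: nmin; rewrite sub1set eG; split=> // Y /andP[_ ncoY].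
rewrite subset1 => /orP[/eqP //|/eqP Y0]; case/negP: ncoY.
have [B bB] := max_indep_exists (eset G).
apply/coindepP; first by rewrite Y0 sub0set.
exists B; first by rewrite basisE.
by rewrite Y0 setD0; case/maxsetP: bB => /andP[].
Qed.

(** Without coloops, every edge is avoided by some basis. This rules out [B = eset G], and a basis
    avoiding an edge outside [A] would be smaller than [B]. So [A] is [eset G], which covers all
    vertices. *)
Lemma card_basis B :
  no_isolated G -> eset G != set0 ->
  (forall e, e \in eset G -> ~~ is_coloop M e) ->
  basis M B -> #|B|.+1 = #|vset G| + k.
Proof.
move=> /'forall_implyP iso E0 ncol bB.
have bB' := bB; rewrite basisE in bB'.
have /andP[iB _] : indep M B && (B \subset eset G) by case/maxsetP: bB'.
have avoid e : e \in eset G -> exists2 Y, indep M Y & [/\ #|Y| = #|B|,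
    Y \subset eset G & e \notin Y].
  move=> eG; have [Y bY eY] := basis_avoiding eG (ncol _ eG).
  have bY' := bY; rewrite basisE in bY'.
  have /andP[iY YG] : indep M Y && (Y \subset eset G) by case/maxsetP: bY'.
  exists Y => //; split=> //; apply/eqP; rewrite eqn_leq.
  rewrite (max_indep_card _ bB') // (max_indep_card _ bY') //.
  by case/andP: iB.
have covE : cov G (eset G) = vset G.
  apply/eqP; rewrite eqEsubset; apply/andP; split.
    by apply/bigcupsP=> e /ends_sub.
  apply/subsetP=> v /iso; rewrite deg_sum sum_nat_eq0 => /forall_inPn[e eG].
  rewrite addn_eq0 !eqb0 negb_and !negbK => ve; apply/bigcupP; exists e => //.
  by case/orP: ve => // /eqP->; rewrite set11.
have := indep_cover_bound (eset G) iB.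
have /eqP -> : B :\: eset G == set0 by rewrite setD_eq0; case/andP: iB.
rewrite cards0 covE add0n => lt; apply/eqP; rewrite eqn_leq lt /=.
have [BE|[A AE le]] := max_indep_cover (subxx _) bB'.
  have [e eG] := set0Pn _ E0; have [Y _ [cY YG eY]] := avoid _ eG.
  have /subset_leq_card : Y \subset eset G :\ e by rewrite subsetD1 YG.
  by have := cardsD1 e (eset G); rewrite eG cY BE; clear; lia.
have [AE'|nAE] := eqVneq A (eset G).
  by move: le; rewrite AE' setDv cards0 covE.
have [e eD] : exists e, e \in eset G :\: A.
  by apply/set0Pn; apply: contra nAE; rewrite setD_eq0 eqEsubset AE.
have [eG eA] := setDP eD; have [Y iY [cY YG eY]] := avoid _ eG.
have := indep_cover_bound A iY.
have /subset_leq_card : Y :\: A \subset (eset G :\: A) :\ e.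
  by rewrite subsetD1 setSD // inE negb_and eY orbT.
by have := cardsD1 e (eset G :\: A); rewrite eD cY; move: le; clear; lia.
Qed.

End CircularRank.

(** * Vertex stars as cocircuits *)

Theorem theorem3p14 (V E : finType) (k : nat) (hk : 1 <= k)
    (G : graph V E) (x : V) :
  no_isolated G ->
  x \in vset G ->
  connected_matroid (circular_matroid hk G) ->
  #|star G x| <= corank (circular_matroid hk G) + 1 ->
  cocircuit (circular_matroid hk G) (star G x)
  <-> ~ has_tree_component (del_vertex G x).
Proof.
move=> iso xG [E0 _ ncol _] sG.
set M := circular_matroid hk G in E0 ncol sG *.
set S := star G x in sG *; set H := del_vertex G x.
have SG : S \subset eset G by apply/subsetP=> e; rewrite inE => /andP[].
have eH : eset H = eset G :\: S.
  apply/setP=> e; rewrite !inE; case: (e \in eset G); rewrite ?andbF //=.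
  by rewrite andbT -disjoints1 disjoint_sym disjoints_subset.
have cH (Y : {set E}) : Y \subset eset H -> cov G Y \subset vset H.
  by move=> /subsetP YH; apply/bigcupsP=> e /YH /ends_sub.
have vH : #|vset G| = #|vset H|.+1.
  have -> : vset H = vset G :\ x by rewrite setDE.
  by rewrite (cardsD1 x) xG.
have rk B : basis M B -> #|B|.+1 = #|vset G| + k by apply: card_basis.
split=> [/minsetP[/andP[_ ncoS] minS]|notree].
- case/exists_inP=> v vV treeK; set K := component H v in treeK.
  have [e eS] : exists e, e \in S.
    apply/card_gt0P; rewrite lt0n; apply: contraNneq ncoS => /cards0_eq ->.
    have [B bB] := max_indep_exists hk G (eset G).
    apply/coindepP; rewrite ?sub0set //; exists B; first by rewrite basisE.
    by rewrite setD0; case/maxsetP: bB => /andP[].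
  have SeG : S :\ e \subset eset G := subset_trans (subD1set _ _) SG.
  (* Minimality of [S] gives a basis [B] that meets [S] at most in [e], so [B'] lies in [H] and has
     at least [#|vset G| + k - 2] elements. *)
  have /(coindepP hk SeG)[B bB BS] : coindep M (S :\ e).
    apply: contraT => nco; have /setP/(_ e) : S :\ e = S.
      by apply: minS; rewrite ?SeG ?subD1set.
    by rewrite eS !inE eqxx.
  have iB : indep M B by case/maxsetP: bB.
  set B' := B :\ e; have iB' : indep M B' := circular_indepS (subD1set _ _) iB.
  have B'H : B' \subset eset H.
    rewrite eH; apply/subsetP=> f /setD1P[fe /(subsetP BS)].
    by rewrite !inE fe.
  have KH : eset K \subset eset H by apply/subsetP=> f; rewrite inE => /andP[].
  have vKH : vset K \subset vset H := subsetIl _ _.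
  have out : cov G (B' :\: eset K) \subset vset H :\: vset K.
    apply/bigcupsP=> f /setDP[/(subsetP B'H) fH fK]; apply/subsetP=> w wf.
    have wH : w \in vset H by apply: (subsetP (ends_sub fH)).
    rewrite inE wH andbT; apply: contra fK => /setIP[_]; rewrite inE => vw.
    by rewrite inE fH; apply: comp_ends vw fH wf.
  (* The tree [K] has fewer edges than vertices, so splitting [B'] along [K] gives
     [#|B'| <= #|vset H| + k - 2], one less than required. *)
  have := tree_card treeK; have := subset_leq_card out.
  have := indep_cover_bound (B' :\: eset K) iB'.
  rewrite [#|vset H :\: _|]cardsD (setIidPr vKH) setDDr setDv set0U.
  have := subset_leq_card vKH; have := subset_leq_card (subsetIr B' (eset K)).
  have := rk _ bB; have := cardsD1 e B; rewrite -/B'.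
  by case: (e \in B); move: vH; clear; lia.
(* A basis avoiding [S] would cover at most [#|vset G| - 1] vertices, too few for its size. *)
- have ncoS : ~~ coindep M S.
    apply/negP=> /(coindepP hk SG)[B bB]; rewrite -eH => BH.
    have iB : indep M B by case/maxsetP: bB.
    have := indep_cover_bound B iB; rewrite setDv cards0 add0n.
    by have := subset_leq_card (cH _ BH); have := rk _ bB; move: vH; clear; lia.
  have HG : eset H \subset eset G by rewrite eH subsetDl.
  have [B mB] := max_indep_exists hk G (eset H).
  have /andP[iB BH] : indep M B && (B \subset eset H) by case/maxsetP: mB.
  have BG := subset_trans BH HG.
  have [B0 mB0] := max_indep_exists hk G (eset G).
  have bB0 : basis M B0 by rewrite basisE.
  have cB0 := rk _ bB0.
  have rB : #|vset H| + k <= #|B|.+1.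
    have [BE|[A AH le]] := max_indep_cover HG mB.
      (* Here all of [eset H] is independent, and the bound on [#|S|] by the corank gives
         [#|eset H| >= rank M - 1]. *)
      have : rank M = #|B0|.
        apply/eqP; rewrite eqn_leq; apply/andP; split.
          apply/bigmax_leqP=> Y iY; apply: (max_indep_card _ mB0) => //.
          by case/andP: iY.
        by apply: leq_bigmax_cond; case/maxsetP: bB0.
      have B0G : B0 \subset eset G by case/maxsetP: bB0 => /andP[].
      have := subset_leq_card B0G.
      have : corank M = #|eset G| - rank M by [].
      move: sG; rewrite BE eH cardsD (setIidPr SG).
      by have := subset_leq_card SG; move: vH cB0; clear; lia.
    (* Without a tree component, the vertices of [H] outside [cov G A] meet at least as many edges
       as their number, and none of these edges is in [A]. *)
    have cU : #|vset H :\: cov G A| <= #|inc H (vset H :\: cov G A)|.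
      by rewrite leqNgt; apply/negP=> /(inc_lt_tree (subsetDl _ _)).
    have sub : inc H (vset H :\: cov G A) \subset eset H :\: A.
      apply/subsetP=> e; rewrite inE => /andP[eHe /pred0Pn[w /andP[we wD]]].
      rewrite inE eHe andbT; apply/negP=> eA; case/setDP: wD => _ /negP[].
      by apply/bigcupP; exists e.
    have := subset_leq_card sub; move: cU.
    rewrite [#|vset H :\: _|]cardsD (setIidPr (cH _ AH)).
    by have := subset_leq_card (cH _ AH); move: le; clear; lia.
  apply/minsetP; split; first by rewrite SG.
  (* If [Y] omits an edge [e] of [S], then [e |: B] is a basis avoiding [Y]. *)
  move=> Y /andP[YG ncoY] YS; apply/eqP; rewrite eqEsubset YS.
  apply/subsetP=> e eS; apply: contraNT ncoY => eY; apply/coindepP=> //.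
  have [eG xe] : e \in eset G /\ x \in ends G e.
    by move: eS; rewrite inE => /andP.
  have eB : e \notin B.
    by apply/negP=> /(subsetP BH); rewrite eH inE eS.
  have ieB : indep M (e |: B).
    apply/circular_indepP; split=> [|Z ZeB].
      by rewrite subUset sub1set eG.
    have ZB : Z :\ e \subset B by rewrite subDset.
    have [eZ|eZ] := boolP (e \in Z); last first.
      have /circular_indepP[_] := iB; apply; apply/subsetP=> f fZ.
      have := subsetP ZeB _ fZ; rewrite !inE; case/predU1P=> // fe.
      by rewrite -fe fZ in eZ.
    (* No edge of [H] covers [x], so [Z] covers at least one vertex more than [Z :\ e], which pays
       for the edge [e]. *)
    have /circular_indepP[_ /(_ _ ZB)] := iB.
    have xZ : x \in cov G Z by apply/bigcupP; exists e.
    have : cov G (Z :\ e) \subset cov G Z :\ x.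
      rewrite subsetD1 covS ?subD1set //.
      apply/negP=> /(subsetP (cH _ (subset_trans ZB BH))).
      by rewrite !inE eqxx andbF.
    move/subset_leq_card; have := cardsD1 x (cov G Z); rewrite xZ.
    by have := cardsD1 e Z; rewrite eZ; clear; lia.
  have ceB : #|e |: B| = #|B|.+1 by rewrite cardsU1 eB.
  (* By [rB], the independent set [e |: B] is at least as large as the basis [B0]. *)
  exists (e |: B).
    rewrite basisE; apply/maxsetP; rewrite ieB subUset sub1set eG BG.
    split=> // Z /andP[iZ ZG] eBZ; apply/eqP; rewrite eq_sym eqEcard eBZ.
    have := max_indep_card (subxx _) mB0 iZ ZG; move: vH cB0 rB ceB.
    by clear; lia.
  rewrite subUset sub1set inE eY eG /=; apply: subset_trans BH _.
  by rewrite eH setDS.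
Qed.
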